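(* Let $t\ge 3$ and $n$ be integers with $4^t\le n$. Then \[ s(m,n,t)\ge \frac{1}{15}\, m^{\frac{1}{t-1}\left(1-\frac{4^t}{n}\right)}. \]
   Context: Let $[m]=\{1,\dots,m\}$. An $(m,n,s)$-storing scheme is a map $\phi$ from the family of subsets of $[m]$ of size at most $n$ to $\{0,1\}^s$. An $(m,s,t)$-query scheme is a family $\{T_u\}_{u\in[m]}$ of Boolean decision trees of depth at most $t$ whose internal nodes are marked with addresses in $\{1,\dots,s\}$ (outgoing edges labelled $0$ and $1$; probes may be adaptive) and whose leaves are marked Yes/No. An $(m,n,s,t)$-scheme is a pair $(\phi,\{T_u\})$ such that for every $S\subseteq[m]$ with $|S|\le n$ and every $u\in[m]$, $T_u(\phi(S))=\mathrm{Yes}$ iff $u\in S$. $s(m,n,t)$ is the minimum $s$ for which an $(m,n,s,t)$-scheme exists. *)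

(* Defs.v *)
From mathcomp Require Import all_boot all_order all_algebra.
From mathcomp Require Import boolp reals exp.

Set Implicit Arguments.
Unset Strict Implicit.
Unset Printing Implicit Defensive.

(* The universe {1, ..., m} and the addresses {1, ..., s} are 'I_m and 'I_s;
   Yes and No are true and false. *)

Definition small_set (m n : nat) := {S : {set 'I_m} | #|S| <= n}.

Definition storing_scheme (m n s : nat) := small_set m n -> s.-tuple bool.

(* [Probe a T0 T1] reads address [a], then follows [T0] on bit 0 and [T1] on
   bit 1. *)
Inductive decision_tree (s : nat) : Type :=
| Leaf of bool
| Probe of 'I_s & decision_tree s & decision_tree s.

Arguments Leaf {s}.

Fixpoint depth (s : nat) (T : decision_tree s) : nat :=
  match T with
  | Leaf _ => 0
  | Probe _ T0 T1 => (maxn (depth T0) (depth T1)).+1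
  end.

Fixpoint run (s : nat) (T : decision_tree s) (x : s.-tuple bool) : bool :=
  match T with
  | Leaf b => b
  | Probe a T0 T1 => if tnth x a then run T1 x else run T0 x
  end.

Definition query_scheme (m s t : nat) :=
  'I_m -> {T : decision_tree s | depth T <= t}.

Definition is_scheme (m n s t : nat)
    (phi : storing_scheme m n s) (T : query_scheme m s t) : Prop :=
  forall (S : small_set m n) (u : 'I_m),
    run (sval (T u)) (phi S) <-> u \in sval S.

Definition has_scheme (m n s t : nat) : Prop :=
  exists (phi : storing_scheme m n s) (T : query_scheme m s t),
    is_scheme phi T.

(* s(m,n,t).  The default 0 is only used when no scheme exists for any s,
   which requires t = 0: see [has_scheme_bitvector]. *)
Definition min_space (m n t : nat) : nat :=
  if pselect (exists s, `[< has_scheme m n s t >]) is left e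
  then ex_minn e else 0.

Lemma has_scheme_bitvector (m n t : nat) : 0 < t -> has_scheme m n m t.
Proof.
move=> t_gt0.
exists (fun S : small_set m n => [tuple u \in sval S | u < m]).
exists (fun u => exist (fun T => depth T <= t) (Probe u (Leaf false) (Leaf true)) t_gt0).
by move=> S u /=; rewrite tnth_mktuple; case: ifP.
Qed.

Lemma min_spaceP (m n t : nat) : 0 < t ->
  has_scheme m n (min_space m n t) t /\
  (forall s, has_scheme m n s t -> min_space m n t <= s).
Proof.
move=> t_gt0; rewrite /min_space; case: pselect => [e|[]]; last first.
  by exists m; apply/asboolP/has_scheme_bitvector.
case: ex_minnP => s /asboolP Ps min_s; split=> // s' Ps'.
by apply/min_s/asboolP.
Qed.

(* Main.v *)
Require Import Defs.
From mathcomp Require Import all_boot all_order all_algebra.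
From mathcomp Require Import zify ring lra.
From mathcomp Require Import boolp reals exp.
Import Order.TTheory GRing.Theory Num.Theory.

(* A scheme cannot exist if some set [E] of at most [n] elements has a pattern of
   answers that no memory content produces.

   Depth two.  For an element whose tree reads [a] first and [b] after bit [i],
   the adversary can choose the answer so that it forces the implication
   [x_a = i -> x_b = beta] for a [beta] of his choice.  Guess the bit of one cell.
   An implication with known premise determines its target, and one whose target
   is known to be wrong determines its root bit, so knowledge spreads forwards and
   backwards along the elements.  If all cells have degree at least [d], it
   spreads by a factor [d - 2] per round, and by the time [(d - 2)^l] exceeds [s]
   two elements must force different bits on the same cell.  Each of the two
   guesses is refuted using [4 l + 2] elements; pairing elements with equal roots
   makes those of the two guesses disjoint.

   Greater depth.  By pigeonhole many elements share their root cell; half of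
   them refute the bit [0] there and the other half the bit [1], inductively. *)

Set Implicit Arguments.
Unset Strict Implicit.
Unset Printing Implicit Defensive.

(** * Counting: pigeonhole, pairing, minimum degree *)

Lemma leq_card_preim (I C : finType) (k : I -> C) (Q : {set I}) (Y : {set C})
    (d : nat) :
  {in Y, forall y, d <= #|[set u in Q | k u == y]|} ->
  d * #|Y| <= #|[set u in Q | k u \in Y]|.
Proof.
move=> dY; rewrite -[X in _ <= X]sum1_card (partition_big k (mem Y)) /=; last first.
  by move=> u; rewrite inE => /andP[].
rewrite mulnC -sum_nat_const; apply: leq_sum => y yY.
apply: leq_trans (dY _ yY) _; rewrite sum1_card subset_leq_card //.
apply/subsetP => u; rewrite !inE => /andP[uQ /eqP ku].
by rewrite unfold_in /= !inE uQ ku yY eqxx.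
Qed.

Lemma pigeonhole (I C : finType) (k : I -> C) (U : {set I}) (b : nat) :
  0 < #|C| -> #|C| * b <= #|U| ->
  exists c, b <= #|[set u in U | k u == c]|.
Proof.
move=> C0 leU; apply/existsP; apply: contraTT leU; rewrite negb_exists.
move=> /forallP small; rewrite -ltnNge.
have -> : #|U| = \sum_c #|[set u in U | k u == c]|.
  rewrite -sum1_card (partition_big k predT) //=.
  apply: eq_bigr => c _; rewrite -sum1_card; apply: eq_bigl => u.
  by rewrite inE.
have bC c : #|[set u in U | k u == c]| <= b.-1.
  by have := small c; rewrite -ltnNge; case: (b).
have b0 : 0 < b by have /card_gt0P[c _] := C0; have := small c; rewrite -ltnNge; case: (b).
apply: leq_ltn_trans (_ : _ <= \sum_(c : C) b.-1) _; first exact: leq_sum.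
by rewrite sum_nat_const ltn_pmul2l // ltn_predL.
Qed.

Lemma exists_subset_card (I : finType) (U : {set I}) (b : nat) :
  b <= #|U| -> exists2 V : {set I}, V \subset U & #|V| = b.
Proof.
move=> bU; exists [set u in take b (enum U)].
  by apply/subsetP => u; rewrite inE => /mem_take; rewrite mem_enum.
rewrite cardsE (card_uniqP _) ?take_uniq ?enum_uniq //.
by rewrite size_takel // -cardE.
Qed.

(** While more than [#|C|] elements remain, two of them share a key and are set aside as a pair [u],
    [g u]. At most [#|C|] elements stay unpaired. *)
Lemma exists_pairing (I C : finType) (k : I -> C) (U : {set I}) :
  exists V : {set I}, exists g : I -> I,
    [/\ V \subset U, {in V &, injective g},
        {in V, forall u, g u \in U :\: V /\ k (g u) = k u}
      & #|U| <= 2 * #|V| + #|C|].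
Proof.
have [N] := ubnP #|U|; elim: N U => // N IH U UN.
have [UC|CU] := leqP #|U| #|C|.
  exists set0, id; split; rewrite ?sub0set ?cards0 //; last first.
    by move=> u; rewrite inE.
have /dinjectivePn [u uU [v /andP[vu vU] kuv]] : ~~ dinjectiveb k U.
  apply: contraTN CU => /dinjectiveP kinj; rewrite -leqNgt.
  by rewrite -(card_in_imset kinj) max_card.
have cU : #|U| = (#|U :\ u :\ v|).+2.
  by rewrite (cardsD1 u) uU (cardsD1 v (U :\ u)) !inE vu vU.
have [|V [g [VU ginj gV cV]]] := IH (U :\ u :\ v); first by rewrite cU in UN; lia.
have nV w : w \in V -> [/\ w != u, w != v & w \in U].
  by move/(subsetP VU); rewrite !inE => /and3P[-> -> ->].
exists (u |: V), (fun w => if w == u then v else g w); split.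
- by rewrite subUset sub1set uU; apply/subsetP => w /nV[].
- have gv w : w \in V -> g w != v.
    by move=> /gV[]; rewrite !inE => /andP[_ /and3P[]].
  move=> w w'; rewrite !inE => /orP[/eqP->|wV] /orP[/eqP->|w'V] //.
  + have [nw' _ _] := nV _ w'V; rewrite eqxx (negbTE nw') => Y.
    by have := gv _ w'V; rewrite -Y eqxx.
  + have [nw _ _] := nV _ wV; rewrite (negbTE nw) eqxx => Y.
    by have := gv _ wV; rewrite Y eqxx.
  + have [nw _ _] := nV _ wV; have [nw' _ _] := nV _ w'V.
    by rewrite (negbTE nw) (negbTE nw'); exact: ginj.
- move=> w; rewrite in_setU1; case: eqVneq => [-> _|wu /= wV].
    split; last by rewrite kuv.
    rewrite !inE vU (negbTE vu) /= andbT; apply/negP => /nV[].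
    by rewrite eqxx.
  have [] := gV _ wV; rewrite !inE => /andP[gnV /and3P[gv gu gU]] ->.
  by rewrite gU (negbTE gnV) (negbTE gu).
- rewrite cU (cardsU1 u).
  have -> : u \notin V by apply/negP => /nV[]; rewrite eqxx.
  by lia.
Qed.

(** Classes with at most [d] elements are deleted repeatedly. Each deletion removes a pair (index,
    value) from [active] for good, so at most [#|J| * #|C| * d] elements are lost. *)
Lemma exists_min_degree (I J C : finType) (k : J -> I -> C) (P : {set I})
    (d : nat) :
  #|J| * #|C| * d < #|P| ->
  exists Q : {set I}, [/\ Q \subset P, Q != set0 &
    forall j, {in Q, forall u, d < #|[set v in Q | k j v == k j u]|}].
Proof.
pose active (Q : {set I}) := [set jc : J * C | [exists u in Q, k jc.1 u == jc.2]].
have : #|active P| <= #|J| * #|C| by rewrite -card_prod max_card.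
move=> leA ltP.
have {leA}ltP : #|active P| * d < #|P|.
  apply: leq_ltn_trans ltP; by rewrite leq_mul2r leA orbT.
have [N] := ubnP #|P|; elim: N P ltP => // N IH P ltP PN.
case: (boolP [forall j, [forall u in P, d < #|[set v in P | k j v == k j u]|]]).
  move=> /forallP good; exists P; split=> //.
    by rewrite -card_gt0; lia.
  by move=> j u uP; have /forall_inP/(_ _ uP) := good j.
rewrite negb_forall => /existsP[j]; rewrite negb_forall => /existsP[u].
rewrite negb_imply -leqNgt => /andP[uP small].
set X := [set v in P | _] in small.
have XP : X \subset P by apply/subsetP => v; rewrite inE => /andP[].
have cX : #|P| = #|X| + #|P :\: X| by rewrite -(cardsID X P) (setIidPr XP).
have uX : u \in X by rewrite inE uP eqxx.
have X0 : 0 < #|X| by apply/card_gt0P; exists u.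
have cA : #|active (P :\: X)| < #|active P|.
  apply: proper_card; apply/properP; split.
    apply/subsetP => jc; rewrite !inE => /exists_inP[v]; rewrite inE => /andP[_ vP] kv.
    by apply/exists_inP; exists v.
  exists (j, k j u); first by rewrite inE; apply/exists_inP; exists u.
  rewrite inE; apply/exists_inP => -[v]; rewrite !inE => /andP[+ vP] /= kv.
  by rewrite vP kv.
have [||Q [QP Q0 Qd]] := IH (P :\: X).
- by nia.
- by lia.
- by exists Q; split=> //; apply: subset_trans QP (subsetDl _ _).
Qed.

(** * Implication constraints between two cells *)

(** [r u] is the root cell of [u], and [f i u] the cell read after root bit [i]. The pair [sigma u]
    is the adversary's choice of premise bit and target bit. *)
Definition satisfies (I C : finType) (r : I -> C) (f : bool -> I -> C)
    (sigma : I -> bool * bool) (E : {set I}) (x : C -> bool) :=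
  {in E, forall u, x (r u) = (sigma u).1 -> x (f (sigma u).1 u) = (sigma u).2}.

Definition forces (I C : finType) (r : I -> C) (f : bool -> I -> C)
    (sigma : I -> bool * bool) (E : {set I}) (a : C) (i : bool) (v : C) (b : bool) :=
  forall x, satisfies r f sigma E x -> x a = i -> x v = b.

Definition excludes (I C : finType) (r : I -> C) (f : bool -> I -> C)
    (Q : {set I}) (a : C) (i : bool) (N : nat) :=
  exists (sigma : I -> bool * bool) (E : {set I}),
    [/\ E \subset Q, #|E| <= N &
        forall x, satisfies r f sigma E x -> x a <> i].

Lemma satisfiesS (I C : finType) (r : I -> C) (f : bool -> I -> C)
    (sigma sigma' : I -> bool * bool) (E E' : {set I}) (x : C -> bool) :
  E \subset E' -> {in E, sigma =1 sigma'} ->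
  satisfies r f sigma' E' x -> satisfies r f sigma E x.
Proof.
by move=> /subsetP EE' eqs sat u uE; rewrite eqs //; apply/sat/EE'.
Qed.

Lemma forcesS (I C : finType) (r : I -> C) (f : bool -> I -> C)
    (sigma sigma' : I -> bool * bool) (E E' : {set I}) a i v b :
  E \subset E' -> {in E, sigma =1 sigma'} ->
  forces r f sigma E a i v b -> forces r f sigma' E' a i v b.
Proof. by move=> EE' eqs fE x /(satisfiesS EE' eqs); exact: fE. Qed.

(** Under [x a = i] both roots carry [c], and [u] demands [false] at the common target. As [u'] lies
    outside [E], its demand can be reset to [true] without disturbing what [E] forces. *)
Lemma excludes_of_collision (I C : finType) (r : I -> C) (f : bool -> I -> C)
    (Q : {set I}) (a : C) (i : bool) (sigma : I -> bool * bool)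
    (E : {set I}) (c : bool) (u u' : I) :
  u \in Q -> u' \in Q -> E \subset Q -> u' \notin E -> u != u' ->
  forces r f sigma E a i (r u) c -> forces r f sigma E a i (r u') c ->
  sigma u = (c, false) -> f c u = f c u' ->
  excludes r f Q a i (#|E| + 2).
Proof.
move=> uQ u'Q EQ u'E uu' fu fu' su ff.
pose tau w := if w == u' then (c, true) else sigma w.
have tauE : {in E, sigma =1 tau}.
  by move=> w wE; rewrite /tau; case: eqP => // wu'; rewrite -wu' wE in u'E.
exists tau, (u |: (u' |: E)); split.
- by rewrite !subUset !sub1set uQ u'Q.
- by rewrite !cardsU1; do 2!case: (_ \notin _); lia.
move=> x satx xa.
have satE : satisfies r f sigma E x.
  by apply: satisfiesS tauE satx; rewrite setUA subsetUr.
have := satx u; rewrite /tau (negbTE uu') su !inE eqxx /= => /(_ isT (fu _ satE xa)).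
have := satx u'; rewrite /tau eqxx !inE eqxx orbT /= => /(_ isT (fu' _ satE xa)).
by rewrite ff => ->.
Qed.

(** * Spreading knowledge in layers *)

(* Knowing [x a = i], the cells of [K] hold the bits [kappa], each by a chain of
   at most [2 j] constraints; the elements of [F] are still free to force their
   target to [false], and every cell of [K] has used at most one element. *)
Record layer (I C : finType) (r : I -> C) (f : bool -> I -> C) (Q : {set I})
    (a : C) (i : bool) (j : nat) (K : {set C}) (kappa : C -> bool)
    (F : {set I}) (sigma : I -> bool * bool) : Prop := Layer {
  layer_cells : K \subset r @: Q;
  layer_forced : {in K, forall v, exists E : {set I},
    [/\ E \subset [set u in Q | r u \in K], #|E| <= 2 * j &
        forces r f sigma E a i v (kappa v)]};
  layer_free : F \subset [set u in Q | r u \in K];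
  layer_sigma : {in F, forall u, sigma u = (kappa (r u), false)};
  layer_used : forall u u', u \in Q -> u' \in Q -> r u \in K ->
    u \notin F -> u' \notin F -> r u = r u' -> u = u';
  layer_inj : {in F &, forall u u', kappa (r u) = kappa (r u') ->
    f (kappa (r u)) u = f (kappa (r u)) u' -> u = u'} }.

(** All elements rooted at [a] are free. Two with a common target collide at once, with an empty
    chain; otherwise the targets are distinct, as a layer requires. *)
Lemma layer_start (I C : finType) (r : I -> C) (f : bool -> I -> C)
    (Q : {set I}) (a : C) (i : bool) :
  a \in r @: Q ->
  excludes r f Q a i 2 \/
  layer r f Q a i 0 [set a] (fun=> i) [set u in Q | r u == a] (fun=> (i, false)).
Proof.
move=> aQ; set F := [set u in Q | _].
have inF u : (u \in F) = (u \in Q) && (r u == a) by rewrite inE.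
case: (boolP [forall u in F, forall u' in F, (f i u == f i u') ==> (u == u')]).
  move=> finj; right; split.
  - by rewrite sub1set.
  - move=> v; rewrite inE => /eqP->; exists set0.
    by rewrite sub0set cards0; split=> // x _.
  - by apply/subsetP => u; rewrite !inE.
  - by [].
  - move=> u u' uQ u'Q; rewrite inE => ru; rewrite inF uQ ru //.
  - move=> u u' uF u'F _ ff; apply/eqP.
    move: finj => /forall_inP/(_ _ uF)/forall_inP/(_ _ u'F)/implyP; apply.
    exact/eqP.
rewrite negb_forall_in => /exists_inP[u uF]; rewrite negb_forall_in.
move=> /exists_inP[u' u'F]; rewrite negb_imply => /andP[/eqP ff uu']; left.
move: uF u'F; rewrite !inF => /andP[uQ /eqP ru] /andP[u'Q /eqP ru'].
have := (@excludes_of_collision _ _ r f Q a i (fun=> (i, false)) set0 i u u').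
rewrite cards0; apply=> //.
- by rewrite sub0set.
- by rewrite inE.
- by rewrite ru => x.
- by rewrite ru' => x.
Qed.

(** Each known cell is the root of at least [d] elements, at most one of them used, so a fraction at
    least [(d - 1) / d] of the elements rooted at known cells of bit [b] is free. *)
Lemma layer_card (I C : finType) (r : I -> C) (f : bool -> I -> C)
    (Q : {set I}) (a : C) (i : bool) (j : nat) (K : {set C}) (kappa : C -> bool)
    (F : {set I}) (sigma : I -> bool * bool) (d : nat) (b : bool) :
  {in Q, forall u, d <= #|[set v in Q | r v == r u]|} ->
  layer r f Q a i j K kappa F sigma ->
  d.-1 * #|[set u in Q | r u \in [set v in K | kappa v == b]]| <=
  d * #|[set u in F | kappa (r u) == b]|.
Proof.
move=> degr [KQ _ FQ _ Fused _].
set Kb := [set v in K | _]; set R := [set u in Q | _]; set G := [set u in F | _].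
have dK : d * #|Kb| <= #|R|.
  apply: leq_card_preim => v; rewrite inE => /andP[/(subsetP KQ)/imsetP[u uQ ->] _].
  exact: degr.
have RG : #|R| <= #|G| + #|Kb|.
  rewrite -(cardsID G R) leq_add ?subset_leq_card ?subsetIr //.
  have nF u : u \in R :\: G -> [/\ u \in Q, r u \in K, u \notin F & r u \in Kb].
    by rewrite !inE => /andP[+ /and3P[-> -> kb]]; rewrite kb andbT => ->.
  have rinj : {in R :\: G &, injective r}.
    move=> u u' /nF[uQ rK uF _] /nF[u'Q _ u'F _]; exact: Fused.
  rewrite -(card_in_imset rinj) subset_leq_card //.
  by apply/subsetP => _ /imsetP[u /nF[_ _ _ ruK] ->].
by nia.
Qed.

Lemma leq_cards2U (I : finType) (u w : I) (X : {set I}) :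
  #|u |: (w |: X)| <= #|X|.+2.
Proof. by rewrite !cardsU1; do 2!case: (_ \notin _); lia. Qed.

(** The chain is [d (d - 2) G <= (d - 1) (d G - R) <= (d - 1) N <= (d - 1) R' <= d G']. The letters
    are the cardinals of the sets so named in [layer_step]. *)
Lemma growth_arith (d R G M N R' G' : nat) :
  2 < d -> d.-1 * R <= d * G -> d * G <= M -> M <= N + R -> N <= R' ->
  d.-1 * R' <= d * G' -> (d - 2) * G <= G'.
Proof.
case: d => [|[|[|e]]] // _; rewrite /= !subSS subn0 => RG GM MN NR RG'.
rewrite -(leq_pmul2l (ltn0Sn e.+2)).
apply: leq_trans RG'; apply: (@leq_trans (e.+2 * (e.+3 * G - R))); last first.
  by rewrite leq_mul2l; lia.
by rewrite mulnBr; lia.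
Qed.

Lemma neq_negb (b c : bool) : b != c -> b = ~~ c.
Proof. by case: b c => -[]. Qed.

(** The elements of [G] set distinct targets to [false]. An element reading such a target after bit
    [b] can demand [true] there, which forces its root bit to [~~ b]. One such element is spent per
    new cell; the others rooted there become free. *)
Lemma layer_step (I C : finType) (r : I -> C) (f : bool -> I -> C)
    (Q : {set I}) (a : C) (i : bool) (j : nat) (K : {set C}) (kappa : C -> bool)
    (F : {set I}) (sigma : I -> bool * bool) (d : nat) (b : bool) :
  2 < d ->
  {in Q, forall u, d <= #|[set v in Q | r v == r u]|} ->
  (forall c, {in Q, forall u, d <= #|[set v in Q | f c v == f c u]|}) ->
  layer r f Q a i j K kappa F sigma ->
  excludes r f Q a i (4 * j.+1 + 2) \/
  exists K' kappa' F' sigma',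
    layer r f Q a i j.+1 K' kappa' F' sigma' /\
    (d - 2) * #|[set u in F | kappa (r u) == b]| <=
      #|[set u in F' | kappa' (r u) == ~~ b]|.
Proof.
move=> d2 degr degf L.
have RG := layer_card b degr L.
case: (L) => KQ Kf FQ Fs Fused Finj.
set Kb := [set v in K | _] in RG; set R := [set u in Q | _] in RG.
set G := [set u in F | _] in RG *.
have GF u : u \in G -> [/\ u \in F, u \in Q, r u \in K & kappa (r u) = b].
  rewrite inE => /andP[uF /eqP kb]; have := subsetP FQ _ uF.
  by rewrite inE => /andP[uQ ruK]; split.
pose M := [set u in Q | f b u \in f b @: G].
have cY : #|f b @: G| = #|G|.
  apply: card_in_imset => u u' /GF[uF _ _ kb] /GF[u'F _ _ kb'] ff.
  by apply: Finj => //; rewrite kb ?kb'.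
have cM : d * #|G| <= #|M|.
  rewrite -cY; apply: leq_card_preim => _ /imsetP[u /GF[_ uQ _ _] ->].
  exact: degf.
pose N := M :\: R.
have cN : #|M| <= #|N| + #|R|.
  by rewrite -(cardsID R M) addnC leq_add2l subset_leq_card ?subsetIr.
pose W := (r @: N) :\: K.
(* The spent elements: one representative in [N] for each new root cell. *)
pose P := [set u in N | (r u \notin K) && ([pick w in N | r w == r u] == Some u)].
have PN u : u \in P -> [/\ u \in N, u \in Q & r u \in W].
  rewrite inE => /and3P[uN ruK _]; split=> //.
    by move: uN; rewrite !inE => /and3P[].
  by rewrite inE ruK imset_f.
have Pinj u u' : u \in P -> u' \in P -> r u = r u' -> u = u'.
  rewrite !inE => /and3P[_ _ /eqP pu] /and3P[_ _ /eqP pu'] ru.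
  by move: pu; rewrite ru pu' => -[].
have Psurj v : v \in W -> exists2 u, u \in P & r u = v.
  rewrite inE => /andP[vK /imsetP[w wN vE]].
  case Ew: [pick w' in N | r w' == v] => [u|]; last first.
    by move: Ew; case: pickP => // /(_ w); rewrite wN vE eqxx.
  have [uN ru] : u \in N /\ r u = v.
    by move: (Ew); case: pickP => // u' /andP[u'N /eqP ru'] [<-].
  by exists u; rewrite // inE uN ru vK Ew eqxx.
have WK v : v \in W -> v \notin K by rewrite inE => /andP[].
pose K' := K :|: W.
pose kappa' v := if v \in K then kappa v else ~~ b.
pose New := [set u in Q | (r u \in W) && (u \notin P)].
pose F' := F :|: New.
pose sigma' u := if r u \in K then sigma u else
                 if u \in P then (b, true) else (~~ b, false).
have kW v : v \in W -> kappa' v = ~~ b by move=> /WK vK; rewrite /kappa' (negbTE vK).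
have kK v : v \in K -> kappa' v = kappa v by rewrite /kappa' => ->.
have FK u : u \in F -> u \in Q /\ r u \in K.
  by move=> /(subsetP FQ); rewrite inE => /andP[].
have NewW u : u \in New -> [/\ u \in Q, r u \in W & u \notin P].
  by rewrite inE => /and3P[].
have K'Q : K' \subset r @: Q.
  rewrite subUset KQ; apply/subsetP => v /Psurj[u /PN[_ uQ _] <-].
  exact: imset_f.
have sK (E : {set I}) : E \subset [set u in Q | r u \in K] -> {in E, sigma =1 sigma'}.
  move=> /subsetP EK u /EK; rewrite inE => /andP[_ ruK].
  by rewrite /sigma' ruK.
have K'f v : v \in K' -> exists E : {set I},
    [/\ E \subset [set u in Q | r u \in K'], #|E| <= 2 * j.+1, [disjoint E & New] &
        forces r f sigma' E a i v (kappa' v)].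
  have dK (E : {set I}) : E \subset [set u in Q | r u \in K] -> [disjoint E & New].
    move=> /subsetP EK; apply/pred0P => u /=; apply/negP => /andP[/EK].
    rewrite inE => /andP[_ ruK] /NewW[_ /WK]; by rewrite ruK.
  have KK' : [set u in Q | r u \in K] \subset [set u in Q | r u \in K'].
    by apply/subsetP => u; rewrite !inE => /andP[-> ->].
  rewrite inE => /orP[vK|vW].
    have [E [EK cE fE]] := Kf _ vK; exists E; split.
    - exact: subset_trans EK KK'.
    - by apply: leq_trans cE _; rewrite leq_mul2l leqnSn orbT.
    - exact: dK.
    - by rewrite kK //; apply: forcesS (subxx _) (sK _ EK) fE.
  have [u uP ru] := Psurj _ vW; have [uN uQ ruW] := PN _ uP.
  have /imsetP[w wG fw] : f b u \in f b @: G.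
    by move: uN; rewrite !in_set => /and3P[].
  have [wF wQ rwK kw] := GF _ wG.
  have [E [EK cE fE]] := Kf _ rwK.
  (* [E] gives [w] root bit [b], [w] sets the common target to [false], and [u] then rules out [b]
     at its own root: two more constraints per round. *)
  exists (u |: (w |: E)); split.
  - have inK' z : z \in Q -> r z \in K' -> z \in [set u in Q | r u \in K'].
      by move=> zQ rzK; apply/setIdP.
    rewrite !subUset !sub1set !inK' // ?in_setU ?rwK ?ruW ?orbT //=.
    exact: subset_trans EK KK'.
  - rewrite (leq_trans (leq_cards2U _ _ _)) // mulnS add2n !ltnS.
    exact: cE.
  - apply/pred0P => z /=; apply/negP => /andP[+ zN]; have [_ rzW zP] := NewW _ zN.
    rewrite !in_setU1 => /or3P[/eqP zu|/eqP zw|zE].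
    + by rewrite zu uP in zP.
    + by have := WK _ rzW; rewrite zw rwK.
    + by have := disjointFr (dK _ EK) zE; rewrite zN.
  - move=> x satx xa; rewrite kW //.
    have satE : satisfies r f sigma E x.
      apply: satisfiesS (sK _ EK) satx; by rewrite setUA subsetUr.
    have := satx w; rewrite /sigma' rwK Fs // kw !inE eqxx orbT /=.
    move=> /(_ isT); rewrite (fE _ satE xa) kw => /(_ erefl) fw0.
    have := satx u; rewrite /sigma' (negbTE (WK _ ruW)) uP !inE eqxx /=.
    move=> /(_ isT); rewrite fw fw0 ru => H.
    by apply: neq_negb; apply/eqP => /H.
have F's : {in F', forall u, sigma' u = (kappa' (r u), false)}.
  move=> u; rewrite inE => /orP[uF|/NewW[uQ ruW uP]].
    by have [_ ruK] := FK _ uF; rewrite /sigma' ruK Fs // kK.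
  by rewrite /sigma' (negbTE (WK _ ruW)) (negbTE uP) kW.
have F'Q : F' \subset [set u in Q | r u \in K'].
  apply/subsetP => u; rewrite !in_setU => /orP[/FK[uQ ruK]|/NewW[uQ ruW _]].
    by rewrite !inE uQ ruK.
  by rewrite inE uQ in_setU ruW orbT.
(* Two free elements with a common target and the same forced root bit
   contradict each other; the newer of the two occurs in no chain, so its answer
   can be flipped. *)
have collide u u' : u \in F' -> u' \in New -> u != u' ->
    kappa' (r u) = kappa' (r u') -> f (kappa' (r u)) u = f (kappa' (r u)) u' ->
    excludes r f Q a i (4 * j.+1 + 2).
  move=> uF' u'N uu' kuu' ff.
  have [u'Q ru'W _] := NewW _ u'N.
  have /setIdP[uQ ruK'] := subsetP F'Q _ uF'.
  have ru'K' : r u' \in K' by rewrite inE ru'W orbT.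
  have [E [EK cE dE fE]] := K'f _ ruK'; have [E' [EK' cE' dE' fE']] := K'f _ ru'K'.
  have Qsub (X : {set I}) : X \subset [set u in Q | r u \in K'] -> X \subset Q.
    by move=> XK; apply: subset_trans XK _; apply/subsetP => w; rewrite inE => /andP[].
  have := @excludes_of_collision _ _ r f Q a i sigma' (E :|: E') (kappa' (r u)) u u'.
  rewrite uQ u'Q uu' subUset !Qsub // in_setU negb_or.
  rewrite (disjointFl dE) // (disjointFl dE') // F's // => /(_ isT isT isT isT isT).
  move=> [|||//|sg [X [XQ cX xX]]].
  - exact: forcesS (subsetUl _ _) (fun _ _ => erefl) fE.
  - by rewrite kuu'; apply: forcesS (subsetUr _ _) (fun _ _ => erefl) fE'.
  - by [].
  (* Two chains of at most [2 * j.+1] elements, plus the two colliding elements. *)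
  exists sg, X; split=> //; apply: leq_trans cX _.
  rewrite leq_add2r (leq_trans (leq_card_setU E E').1) //.
  by rewrite (leq_trans (leq_add cE cE')) // -mulnDl.
case: (boolP [exists u in F', exists u' in New,
    [&& u != u', kappa' (r u) == kappa' (r u')
      & f (kappa' (r u)) u == f (kappa' (r u)) u']]).
  move=> /exists_inP[u uF' /exists_inP[u' u'N /and3P[uu' /eqP kk /eqP ff]]].
  by left; apply: collide kk ff.
move=> /exists_inPn noc; right.
have F'inj1 u u' : u \in F' -> u' \in New -> kappa' (r u) = kappa' (r u') ->
    f (kappa' (r u)) u = f (kappa' (r u)) u' -> u = u'.
  move=> uF' u'N kk ff; have /exists_inPn/(_ _ u'N) := noc _ uF'.
  by rewrite kk eqxx -kk ff eqxx !andbT negbK => /eqP.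
have L' : layer r f Q a i j.+1 K' kappa' F' sigma'.
  split=> //.
  - by move=> v /K'f[E [? ? _ ?]]; exists E.
  - move=> u u' uQ u'Q; rewrite in_setU => /orP[ruK|ruW] uF' u'F' ru.
      move: uF' u'F'; rewrite !in_setU !negb_or => /andP[uF _] /andP[u'F _].
      exact: Fused.
    have inP w : w \in Q -> r w \in W -> w \notin F' -> w \in P.
      move=> wQ rwW; rewrite in_setU negb_or => /andP[_].
      by rewrite inE wQ rwW /= negbK.
    by apply: Pinj => //; apply: inP => //; rewrite -ru.
  - move=> u u' uF' u'F' kk ff.
    move: (u'F'); rewrite in_setU => /orP[u'F|u'N]; last exact: F'inj1.
    move: (uF'); rewrite in_setU => /orP[uF|uN].
      have [_ ruK] := FK _ uF; have [_ ru'K] := FK _ u'F.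
      by move: kk ff; rewrite !kK //; apply: Finj.
    by apply/esym/F'inj1 => //; rewrite -kk.
exists K', kappa', F', sigma'; split=> //.
have := layer_card (~~ b) degr L'.
set R' := [set u in Q | _]; set G' := [set u in F' | _] => RG'.
(* An element of [N] is rooted either in [K], with bit other than [b] because [N] avoids [R], or at
   a new cell, whose bit is [~~ b]. *)
have cR' : #|N| <= #|R'|.
  apply: subset_leq_card; apply/subsetP => u uN.
  move: (uN); rewrite !in_set => /andP[uR /andP[uQ _]]; rewrite uQ /=.
  have [ruK|ruK] := boolP (r u \in K).
    rewrite /= kK //; move: uR; rewrite uQ ruK /=.
    by move/neq_negb ->.
  by rewrite imset_f //= /kappa' (negbTE ruK).
exact: growth_arith d2 RG cM cN cR' RG'.
Qed.

(** Free elements with root bit [b] have distinct targets, so there are at most [#|C|] of them,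
    whereas [l] rounds without collision would produce [(d - 2) ^ l]. The bit [b] starts at [i] and
    flips each round. *)
Lemma excludes_min_degree (I C : finType) (r : I -> C) (f : bool -> I -> C)
    (Q : {set I}) (a : C) (i : bool) (d l : nat) :
  2 < d ->
  {in Q, forall u, d <= #|[set v in Q | r v == r u]|} ->
  (forall c, {in Q, forall u, d <= #|[set v in Q | f c v == f c u]|}) ->
  a \in r @: Q -> #|C| < (d - 2) ^ l ->
  excludes r f Q a i (4 * l + 2).
Proof.
move=> d2 degr degf aQ Cl.
have mono N N' : N <= N' -> excludes r f Q a i N -> excludes r f Q a i N'.
  move=> NN' [sg [E [EQ cE xE]]]; exists sg, E; split=> //.
  exact: leq_trans NN'.
have : excludes r f Q a i (4 * l + 2) \/
  exists b K kappa F sigma, layer r f Q a i l K kappa F sigma /\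
    (d - 2) ^ l <= #|[set u in F | kappa (r u) == b]|.
  elim: l {Cl} => [|l IH].
    have [|L] := layer_start f i aQ; first by left; rewrite muln0.
    right; exists i; do 4!eexists; split; first exact: L.
    rewrite expn0; have /imsetP[u uQ ->] := aQ.
    by apply/card_gt0P; exists u; rewrite !inE uQ !eqxx.
  have [/mono xl|[b [K [kappa [F [sigma [L cF]]]]]]] := IH.
    by left; apply: xl; lia.
  have [xl|[K' [kappa' [F' [sigma' [L' cF']]]]]] := layer_step b d2 degr degf L.
    by left.
  right; exists (~~ b), K', kappa', F', sigma'; split=> //.
  by apply: leq_trans cF'; rewrite expnS leq_mul2l cF orbT.
move=> [//|[b [K [kappa [F [sigma [L cF]]]]]]].
have finj : {in [set u in F | kappa (r u) == b] &, injective (f b)}.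
  move=> u u'; rewrite !inE => /andP[uF /eqP kb] /andP[u'F /eqP kb'] ff.
  by apply: (layer_inj L) => //; rewrite kb ?kb'.
have := max_card (f b @: [set u in F | kappa (r u) == b]).
by rewrite (card_in_imset finj); lia.
Qed.

(** * Decision trees and refutable answer patterns *)

(* Leaves get the junk address [c0]. *)
Definition root_address (s : nat) (c0 : 'I_s) (T : decision_tree s) : 'I_s :=
  if T is Probe c _ _ then c else c0.

Definition subtree (s : nat) (i : bool) (T : decision_tree s) : decision_tree s :=
  match T with
  | Leaf b => Leaf b
  | Probe _ T0 T1 => if i then T1 else T0
  end.

Lemma run_subtree (s : nat) (c0 : 'I_s) (T : decision_tree s) (x : s.-tuple bool) :
  run T x = run (subtree (tnth x (root_address c0 T)) T) x.
Proof. by case: T => //= c T0 T1; case: (tnth _ _). Qed.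

Lemma depth_subtree (s : nat) (i : bool) (T : decision_tree s) :
  depth (subtree i T) <= (depth T).-1.
Proof. by case: T i => //= c T0 T1 []; rewrite ?leq_maxl ?leq_maxr. Qed.

Lemma depth0_run (s : nat) (T : decision_tree s) :
  depth T <= 0 -> exists b, forall x, run T x = b.
Proof. by case: T => // b _; exists b. Qed.

(* Demanding the answer opposite to the one given on root bit [i] and child bit
   [~~ b] turns a depth-two tree into an implication between two cells. *)
Lemma depth2_answer (s : nat) (c0 : 'I_s) (T : decision_tree s) (i b : bool) :
  depth T <= 2 ->
  exists y, forall x, run T x = y -> tnth x (root_address c0 T) = i ->
    tnth x (root_address c0 (subtree i T)) = b.
Proof.
move=> T2; set Ti := subtree i T.
have Tib : depth (subtree (~~ b) Ti) <= 0.
  have := depth_subtree (~~ b) Ti; have := depth_subtree i T; rewrite -/Ti.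
  by move: (depth _) T2 (depth Ti) (depth _); lia.
have [y Ey] := depth0_run Tib.
exists (~~ y) => x; rewrite (run_subtree c0) => + xi; rewrite xi -/Ti.
rewrite (run_subtree c0 Ti) => E; apply/eqP; apply: contraPT E => /neq_negb ->.
by rewrite Ey; case: y {Ey}.
Qed.

Definition refutable (I : finType) (s : nat) (T : I -> decision_tree s)
    (U : {set I}) (N : nat) :=
  exists (E : {set I}) (y : I -> bool),
    [/\ E \subset U, #|E| <= N &
        forall x, ~ {in E, forall u, run (T u) x = y u}].

(** [J] indexes pairs of elements with a common root; [e c p] is the member of pair [p] reserved for
    refuting bit [c] at [a]. The two sides use disjoint elements, so their demanded answers can be
    merged. *)
Lemma refutable_of_excludes (I J : finType) (s : nat) (c0 : 'I_s)
    (T : I -> decision_tree s) (U : {set I}) (r : J -> 'I_s)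
    (f : bool -> bool -> J -> 'I_s) (e : bool -> J -> I) (Q : {set J})
    (a : 'I_s) (N : nat) :
  {in U, forall u, depth (T u) <= 2} ->
  (forall c, {in Q &, injective (e c)}) ->
  {in Q &, forall p q, e false p != e true q} ->
  (forall c, {in Q, forall p, e c p \in U}) ->
  (forall c, {in Q, forall p, root_address c0 (T (e c p)) = r p}) ->
  (forall c i, {in Q, forall p,
    root_address c0 (subtree i (T (e c p))) = f c i p}) ->
  (forall c, excludes r (f c) Q a c N) ->
  refutable T U (2 * N).
Proof.
move=> T2 einj edisj eU er ef ex.
have side c : exists (E : {set J}) (y : I -> bool), [/\ E \subset Q, #|E| <= N &
    forall x : s.-tuple bool,
      {in e c @: E, forall u, run (T u) x = y u} -> tnth x a <> c].
  have [sg [E [EQ cE xE]]] := ex c.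
  (* Injectivity of [e c] ties [u] to a single [p]; elements outside the image get the junk answer
     [true]. *)
  have /choice[y Hy] : forall u, exists y, forall p, p \in E -> u = e c p ->
      forall x, run (T u) x = y -> tnth x (r p) = (sg p).1 ->
        tnth x (f c (sg p).1 p) = (sg p).2.
    move=> u; have [/imsetP[p pE ->]|uE] := boolP (u \in e c @: E); last first.
      by exists true => p pE up; move: uE; rewrite up imset_f.
    have pQ := subsetP EQ _ pE.
    have [y yP] := depth2_answer c0 (sg p).1 (sg p).2 (T2 _ (eU c _ pQ)).
    exists y => q qE /einj pq x; rewrite -(pq pQ (subsetP EQ _ qE)).
    by rewrite -(er c) // -(ef c) //; exact: yP.
  exists E, y; split=> // x xy; apply: (xE (fun v => tnth x v)) => p pE.
  by apply: (Hy _ _ pE erefl); apply: xy; apply: imset_f.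
have [E0 [y0 [E0Q c0' x0]]] := side false; have [E1 [y1 [E1Q c1 x1]]] := side true.
exists (e false @: E0 :|: e true @: E1),
  (fun u => if u \in e false @: E0 then y0 u else y1 u); split.
- rewrite subUset; apply/andP; split; apply/subsetP => _ /imsetP[p pE ->].
    exact: eU (subsetP E0Q _ pE).
  exact: eU (subsetP E1Q _ pE).
- rewrite mul2n -addnn (leq_trans (leq_card_setU _ _).1) //.
  by rewrite leq_add // (leq_trans (leq_imset_card _ _)).
move=> x xy; case xa: (tnth x a); [apply: (x1 x) xa|apply: (x0 x) xa] => u uE.
  rewrite xy ?in_setU ?uE ?orbT //; case: imsetP => // -[p pE upE].
  move: uE; rewrite upE => /imsetP[q qE]; apply: contra_eq => _ /=.
  exact: edisj (subsetP E0Q _ pE) (subsetP E1Q _ qE).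
by rewrite xy ?in_setU uE.
Qed.

(** Pairing costs a factor 2 and [s] elements, and five keys of [s] values each need more than
    [5 * s * (d - 1)] pairs; [10 * s * d] covers both. *)
Lemma refutable_depth2 (I : finType) (s : nat) (c0 : 'I_s)
    (T : I -> decision_tree s) (U : {set I}) (d l : nat) :
  2 < d -> s < (d - 2) ^ l -> {in U, forall u, depth (T u) <= 2} ->
  10 * s * d <= #|U| -> refutable T U (8 * l + 4).
Proof.
move=> d2 sl T2 cU.
have s0 : 0 < s by case: s c0 {T T2 sl cU} => // -[].
have [P [g [PU ginj gP cP]]] := exists_pairing (fun u => root_address c0 (T u)) U.
pose e (c : bool) p := if c then g p else p.
pose f c i p := root_address c0 (subtree i (T (e c p))).
(* The five keys: the common root, and the next cell for each member of the pair and each root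
   bit. *)
pose k (o : option (bool * bool)) p :=
  if o is Some (c, i) then f c i p else root_address c0 (T p).
have [|Q [QP Q0 Qd]] := @exists_min_degree _ _ _ k P d.-1.
  rewrite card_option card_prod card_bool card_ord -(ltn_pmul2l (isT : 0 < 2)).
  rewrite card_ord in cP.
  suff : 2 * (5 * s * d.-1) + s < 10 * s * d by move: cU cP; lia.
  by case: (d) d2 => // d' _ /=; nia.
have dd n : d.-1 < n -> d <= n by case: (d) d2.
have [p0 p0Q] := set0Pn _ Q0.
have subP p : p \in Q -> p \in P := subsetP QP p.
have -> : 8 * l + 4 = 2 * (4 * l + 2) by lia.
apply: (@refutable_of_excludes _ _ _ c0 T U (k None) f e Q (k None p0)) => //.
- move=> [] p q /subP pP /subP qP //=; exact: ginj.
- move=> p q /subP pP /subP qP /=; apply: contraTneq pP => ->.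
  by have [] := gP _ qP; rewrite inE => /andP[].
- move=> [] p /subP pP /=; last exact: (subsetP PU).
  by have [] := gP _ pP; rewrite inE => /andP[].
- by move=> [] p /subP pP //=; have [] := gP _ pP.
move=> c; apply: (@excludes_min_degree _ _ _ _ _ _ _ d) => //.
- by move=> p pQ; apply/dd/(Qd None).
- by move=> i p pQ; apply/dd/(Qd (Some (c, i))).
- exact: imset_f.
- by rewrite card_ord.
Qed.

Lemma refutable_depth (I : finType) (s : nat) (c0 : 'I_s) (d l t : nat)
    (T : I -> decision_tree s) (U : {set I}) :
  2 < d -> s < (d - 2) ^ l -> {in U, forall u, depth (T u) <= t.+2} ->
  (2 * s) ^ t * (10 * s * d) <= #|U| -> refutable T U (2 ^ t * (8 * l + 4)).
Proof.
move=> d2 sl; elim: t T U => [|t IH] T U Tt cU.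
  rewrite expn0 mul1n; apply: (refutable_depth2 c0 d2 sl Tt).
  by rewrite -[X in X <= _]mul1n.
have s0 : 0 < #|'I_s| by rewrite card_ord; case: s c0 {T IH sl Tt cU} => // -[].
pose B := (2 * s) ^ t * (10 * s * d).
(* [2 * B] elements share a root, so each bit there gets [B] elements of its own. *)
have [|a Va] := @pigeonhole _ _ (fun u => root_address c0 (T u)) U (2 * B) s0.
  by rewrite card_ord; apply: leq_trans cU; rewrite /B expnS; lia.
set V := [set u in U | _] in Va.
have [|V0 V0V cV0] := @exists_subset_card _ V B; first by apply: leq_trans Va; lia.
have VU u : u \in V -> u \in U /\ root_address c0 (T u) = a.
  by rewrite inE => /andP[uU /eqP].
have dsub i u : u \in V -> depth (subtree i (T u)) <= t.+2.
  move=> /VU[uU _]; apply: leq_trans (depth_subtree _ _) _.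
  by have := Tt _ uU; case: (depth _).
have [||E0 [y0 [E0V cE0 x0]]] := IH (fun u => subtree false (T u)) V0.
- by move=> u /(subsetP V0V) uV; apply: dsub.
- by rewrite -/B cV0.
have [||E1 [y1 [E1V cE1 x1]]] := IH (fun u => subtree true (T u)) (V :\: V0).
- by move=> u; rewrite inE => /andP[_ uV]; apply: dsub.
- by rewrite -/B; move: Va; rewrite -(cardsID V0 V) (setIidPr V0V) cV0; lia.
have E0U u : u \in E0 -> u \in V by move=> /(subsetP E0V) /(subsetP V0V).
have E1U u : u \in E1 -> u \notin V0 /\ u \in V.
  by move=> /(subsetP E1V); rewrite inE => /andP[].
exists (E0 :|: E1), (fun u => if u \in V0 then y0 u else y1 u); split.
- rewrite subUset; apply/andP; split; apply/subsetP => u.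
    by move=> /E0U /VU[].
  by move=> /E1U[_ /VU[]].
- rewrite expnS -mulnA mul2n -addnn (leq_trans (leq_card_setU _ _).1) //.
  exact: leq_add.
move=> x xy; case xa: (tnth x a).
  apply: (x1 x) => u uE1; have [uV0 uV] := E1U _ uE1; have [_ ra] := VU _ uV.
  have := xy u; rewrite in_setU uE1 orbT (negbTE uV0) (run_subtree c0) ra xa.
  by apply.
apply: (x0 x) => u uE0; have [_ ra] := VU _ (E0U _ uE0).
have := xy u; rewrite in_setU uE0 (subsetP E0V _ uE0) (run_subtree c0) ra xa.
by apply.
Qed.

(** * From refutations to a bound on [m] *)

(** The set to store consists of the elements of [E] whose prescribed answer is Yes; its memory
    content would produce the pattern. *)
Lemma has_scheme_not_refutable (m n s t : nat) (T : query_scheme m s t)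
    (phi : storing_scheme m n s) (U : {set 'I_m}) :
  is_scheme phi T -> ~ refutable (fun u => sval (T u)) U n.
Proof.
move=> sch [E [y [_ cE xE]]].
have cS : #|[set u in E | y u]| <= n.
  by apply: leq_trans cE; apply/subset_leq_card/subsetP => u; rewrite inE => /andP[].
apply: (xE (phi (exist _ [set u in E | y u] cS))) => u uE.
by apply/idP/idP => [/sch|yu]; [|apply/sch]; rewrite /= inE uE.
Qed.

(** Without cells every tree is a leaf, which cannot tell the empty set from a singleton. *)
Lemma has_scheme_space_gt0 (m n s t : nat) :
  0 < m -> 0 < n -> has_scheme m n s t -> 0 < s.
Proof.
move=> m0 n0 [phi [T sch]]; rewrite lt0n; apply/negP => /eqP s0.
subst s; pose u : 'I_m := Ordinal m0.
have [b Tb] : exists b, sval (T u) = Leaf b.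
  by case: (sval (T u)) => [b|[]]; [exists b|].
have small (S : {set 'I_m}) : #|S| <= 1 -> (u \in S) = b.
  move=> S1; have Sn := leq_trans S1 n0.
  have [] := sch (exist _ S Sn) u; rewrite Tb /= => bS Sb.
  by apply/idP/idP.
have := small set0; have := small [set u].
by rewrite cards0 cards1 in_set0 set11 => /(_ isT) <- /(_ isT).
Qed.

Lemma has_scheme_card (m n s t d l : nat) :
  0 < s -> 2 < d -> s < (d - 2) ^ l -> 2 ^ t * (8 * l + 4) <= n ->
  has_scheme m n s t.+2 -> m < (2 * s) ^ t * (10 * s * d).
Proof.
move=> s0 d2 sl ln [phi [T sch]]; rewrite ltnNge; apply/negP => leB.
apply: (has_scheme_not_refutable (U := [set: 'I_m]) sch).
have [||E [y [EU cE xE]]] := @refutable_depth _ _ (Ordinal s0) d l t (fun u => sval (T u))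
  [set: 'I_m] d2 sl.
- by move=> u _; case: (T u).
- by rewrite cardsT card_ord.
by exists E, y; split=> //; apply: leq_trans cE ln.
Qed.

(** With [w = 2 ^ t] and [q = n %/ 4 ^ t.+2] the claim reduces to [8 q + 12 <= 16 w q], true for
    [w >= 2] and [q >= 1]; it fails at [w = q = 1], hence [0 < t]. *)
Lemma leq_expn4_levels (t n : nat) : 0 < t -> 4 ^ t.+2 <= n ->
  2 ^ t * (8 * (n %/ 4 ^ t.+2).+1 + 4) <= n.
Proof.
move=> t0 le4n; set q := n %/ _.
have q1 : 0 < q by rewrite divn_gt0 // expn_gt0.
apply: leq_trans (leq_trunc_div n (4 ^ t.+2)); rewrite -/q.
have -> : 4 ^ t.+2 = 2 ^ t * (2 ^ t * 16).
  have e4 : 4 ^ t = 2 ^ t * 2 ^ t by rewrite -expnMn.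
  by rewrite !expnS e4; lia.
have : 2 <= 2 ^ t by rewrite -{1}(expn1 2) leq_exp2l.
move: (2 ^ t) => w w2.
rewrite [leqRHS]mulnCA leq_mul2l; apply/orP; right; nia.
Qed.

(** * Real estimates *)

Local Open Scope ring_scope.

(** With [D] the real power, [d - 2] is the floor of [D] plus 1, so it exceeds [D]; and [D] to the
    [n %/ q + 1] is at least [m] because that exponent exceeds [n / q]. Also [d <= D + 3 <= 4 D],
    since [D >= 1]. *)
Lemma powR_ratio_gt (R : realType) (m n q : nat) (d := (Num.truncn (m%:R `^ (q%:R / n%:R) : R)).+3) :
  (0 < m)%N -> (0 < q)%N -> (0 < n)%N ->
  (m < (d - 2) ^ (n %/ q).+1)%N /\ d%:R <= 4 * m%:R `^ (q%:R / n%:R) :> R.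
Proof.
move=> m0 q0 n0; set D : R := m%:R `^ _ in d *.
have m1 : 1 <= m%:R :> R by rewrite ler1n.
have e0 : 0 <= q%:R / n%:R :> R by rewrite divr_ge0.
have D1 : 1 <= D by rewrite -(powRr0 m%:R) ler_powR.
have D0 : 0 <= D by apply: le_trans D1.
have /andP[tD Dt] := truncn_itv D0.
split; last first.
  rewrite /d -addn3 natrD; lra.
rewrite /d subn2 /= -(ltr_nat R) natrX.
apply: (@le_lt_trans _ _ (D ^+ (n %/ q).+1)); last by rewrite ltrXn2r.
rewrite /D -powR_mulrn ?powR_ge0 // -powRrM -[X in X <= _]powRr1 //.
apply: ler_powR => //.
rewrite mulrAC ler_pdivlMr ?ltr0n // mul1r -natrM ler_nat.
by rewrite mulnC ltnW // -ltn_divLR.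
Qed.

Unset Implicit Arguments.

Theorem theorem6 (R : realType) (m n t : nat) (m_gt0 : (0 < m)%N)
    (t_ge3 : (3 <= t)%N) (le_4t_n : (4 ^ t <= n)%N) :
  15%:R^-1 * m%:R `^ ((t%:R - 1)^-1 * (1 - 4%:R ^+ t / n%:R))
    <= (min_space m n t)%:R :> R.
Proof.
have t0 : (0 < t)%N by lia.
have q0 : (0 < 4 ^ t)%N by rewrite expn_gt0.
have n0 : (0 < n)%N by apply: leq_trans le_4t_n.
have [sch min_s] := min_spaceP m n t0.
(* Since [s <= m], it is enough that [(d - 2) ^ l] exceeds [m], so [d] can be chosen without knowing
   [s]. *)
have sm := min_s _ (has_scheme_bitvector m n t0).
move: (min_space m n t) sch sm => s sch sm {min_s}.
have s0 := has_scheme_space_gt0 m_gt0 n0 sch.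
have [] := @powR_ratio_gt R m n (4 ^ t) m_gt0 q0 n0.
set d := _.+3; set D : R := _ `^ _ => md dD.
(* From here on [t] is the original depth bound minus 2. *)
case: t => [|[|t]] // in t_ge3 le_4t_n t0 q0 sch d D md dD *.
have lt_m : (m < (2 * s) ^ t * (10 * s * d))%N.
  apply: has_scheme_card s0 _ (leq_ltn_trans sm md) _ sch => //.
  exact: leq_expn4_levels.
have m1 : 1 <= m%:R :> R by rewrite ler1n.
have mR0 : 0 < m%:R :> R by rewrite ltr0n.
have D0 : 0 < D by rewrite powR_gt0.
have t1 : (t.+2)%:R - 1 = (t.+1)%:R :> R by rewrite -natr1 addrK.
rewrite t1 powRrM.
(* Dividing [m <= (15 s) ^ t.+1 * D] by [D] subtracts [4 ^ t.+2 / n] from the exponent of [m]. *)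
have key : m%:R `^ (1 - 4 ^+ t.+2 / n%:R) <= (15 * s%:R) ^+ t.+1 :> R.
  rewrite powRD; last by rewrite (lt0r_neq0 mR0) implybT.
  rewrite powRr1 ?ler0n // powRN -natrX -/D ler_pdivrMr //.
  have sR : 1 <= s%:R :> R by rewrite ler1n.
  have /ltnW := lt_m; rewrite -(ler_nat R) !natrM natrX natrM => le_m.
  apply: le_trans le_m _.
  (* The 40 is the 10 of the depth-two bound times the 4 of [d <= 4 D]. As [t >= 1], the base case
     is [2 * 40 <= 15 ^ 2]. *)
  have pw : 2 ^+ t * 40 <= 15 ^+ t.+1 :> R.
    case: (t) t_ge3 => // u _; rewrite !exprS.
    have : 2 ^+ u <= 15 ^+ u :> R by rewrite lerXn2r ?nnegrE //; lra.
    have : 0 <= 15 ^+ u :> R by rewrite exprn_ge0.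
    lra.
  rewrite !exprMn !exprS in pw *.
  have st0 : 0 <= s%:R ^+ t :> R by rewrite exprn_ge0.
  apply: (@le_trans _ _ ((2 ^+ t * s%:R ^+ t) * (10 * s%:R * (4 * D)))).
    by rewrite ler_wpM2l ?ler_wpM2l ?mulr_ge0 ?exprn_ge0.
  have -> : (2 ^+ t * s%:R ^+ t) * (10 * s%:R * (4 * D)) =
      (2 ^+ t * 40) * (s%:R * s%:R ^+ t * D) by ring.
  by rewrite -[leRHS]mulrA ler_wpM2r ?mulr_ge0 ?exprn_ge0 ?(ltW D0).
rewrite ler_pdivrMl // powRAC.
apply: (@le_trans _ _ (((15 * s%:R) ^+ t.+1) `^ (t.+1)%:R^-1)).
  by apply: ge0_ler_powR key; rewrite ?invr_ge0 ?nnegrE ?powR_ge0 ?exprn_ge0 ?mulr_ge0.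
by rewrite -powR_mulrn ?mulr_ge0 // -powRrM mulfV ?pnatr_eq0 // powRr1 ?mulr_ge0.
Qed.
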